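(* Let $d\ge2$ be an even integer and let $\Phi=\{\varphi_i\}_{i=1}^n$ be an equiangular sequence of $n$ vectors in $\mathbb{R}_{\mathcal S}^d$. Then $n\le d+1$.
   Context: For an even integer $d\ge 2$, let $\Omega$ be the $d\times d$ block-diagonal matrix consisting of $d/2$ diagonal blocks $\begin{bmatrix}0&1\\-1&0\end{bmatrix}$, and let $[x,y]=x^\top\Omega y$ on $\mathbb{R}^d$. The space $\mathbb{R}^d$ with this symplectic form is denoted $\mathbb{R}_{\mathcal S}^d$. A sequence $\Phi=\{\varphi_i\}_{i=1}^n$ of vectors in $\mathbb{R}_{\mathcal S}^d$ is equiangular if there exists $\mu>0$ such that $|[\varphi_i,\varphi_j]|=\mu$ for all $i\neq j$. *)

(* Defs.v *)
From mathcomp Require Import all_boot all_order all_algebra.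
From mathcomp Require Import reals.

Set Implicit Arguments.
Unset Strict Implicit.
Unset Printing Implicit Defensive.

Import Order.TTheory GRing.Theory Num.Theory.

Local Open Scope ring_scope.

(* Indices are 0-based, so when d is even the k-th 2 x 2 diagonal block
   occupies the rows and columns 2k and 2k+1. *)
Definition Omega (R : realType) (d : nat) : 'M[R]_d :=
  \matrix_(i < d, j < d)
    if ~~ odd i && (nat_of_ord j == i.+1) then 1
    else if odd i && (nat_of_ord i == j.+1) then -1
    else 0.

Definition sympl (R : realType) (d : nat) (x y : 'cV[R]_d) : R :=
  (x^T *m Omega R d *m y) ord0 ord0.

Definition equiangular (R : realType) (d n : nat) (Phi : 'I_n -> 'cV[R]_d) :
    Prop :=
  exists mu : R, 0 < mu /\
    forall i j : 'I_n, i <> j -> `|sympl (Phi i) (Phi j)| = mu.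

(* Main.v *)
Require Import Defs.
From mathcomp Require Import all_boot all_order all_algebra.
From mathcomp Require Import reals.

(** The Gram matrix of a family of vectors of the symplectic space has rank at
    most [d], and for an equiangular family it is, up to the factor [mu], an
    integer matrix with zero diagonal (the form is alternating) and entries
    1 or -1 elsewhere.  Modulo 2 the signs disappear: the matrix becomes
    [J - I], with [J] the all-ones matrix, and if its size [m] is even then
    [(J - I) ^ 2 = m J - 2 J + I = I].  Hence its determinant is odd, so the
    Gram matrix of an even number [m] of vectors is invertible and [m <= d].
    When [d] is even, a family of more than [d + 1] vectors would contain a
    subfamily of exactly [d + 2] vectors, an even number: a contradiction. *)

Set Implicit Arguments.
Unset Strict Implicit.
Unset Printing Implicit Defensive.

Import Order.TTheory GRing.Theory Num.Theory.

Local Open Scope ring_scope.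

Lemma natr_F2 (n : nat) : n%:R = (odd n)%:R :> 'F_2.
Proof.
have two0 : 2%:R = 0 :> 'F_2 by apply/val_inj.
by rewrite -{1}[n]odd_double_half natrD -muln2 natrM two0 mulr0 addr0.
Qed.

Lemma intr_F2 (x : int) : x%:~R = (odd `|x|%N)%:R :> 'F_2.
Proof.
case: x => n; first exact: natr_F2.
rewrite NegzE mulrNz abszN absz_nat -pmulrn.
have -> : n.+1%:R = (odd n.+1)%:R :> 'F_2 by exact: natr_F2.
by case: (odd _); apply/val_inj.
Qed.

(** Modulo 2 such a matrix is [J - I], which is its own inverse in even size. *)
Lemma det_odd_offdiag_neq0 (m : nat) (A : 'M[int]_m) :
  ~~ odd m -> (forall i j, odd `|A i j|%N = (i != j)) -> \det A != 0.
Proof.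
move=> m_even A_parity; apply/eqP => detA0.
pose J : 'M['F_2]_m := const_mx 1.
have A_mod2 : map_mx intr A = J - 1%:M.
  apply/matrixP => i j; rewrite !mxE intr_F2 A_parity.
  by case: (i == j); apply/val_inj.
have JJ0 : J *m J = 0.
  apply/matrixP => i j; rewrite !mxE.
  under eq_bigr do rewrite !mxE mulr1.
  by rewrite sumr_const card_ord natr_F2 (negbTE m_even).
have J2 : J + J = 0 by apply/matrixP => i j; rewrite !mxE; apply/val_inj.
have sq1 : (J - 1%:M) *m (J - 1%:M) = 1%:M.
  rewrite mulmxBl !mulmxBr JJ0 !mulmx1 mul1mx sub0r opprB addrCA.
  by rewrite -opprD J2 oppr0 addr0.
have := congr1 (fun M => \det M) sq1.
by rewrite det_mulmx det1 -A_mod2 det_map_mx detA0 mulr0 => /eqP.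
Qed.

Lemma Omega_tr (R : realType) (d : nat) : (Omega R d)^T = - Omega R d.
Proof.
apply/matrixP => i j; rewrite !mxE.
have [->|ij] := eqVneq (nat_of_ord i) j.+1 => /=.
  rewrite ltn_eqF ?(leqW (ltnSn _)) //= !andbF !andbT.
  by case: (odd j); rewrite /= ?opprK ?oppr0.
rewrite !andbF.
have [->|_] := eqVneq (nat_of_ord j) i.+1 => /=; last by rewrite !andbF oppr0.
by rewrite !andbT; case: (odd i); rewrite /= ?oppr0.
Qed.

Lemma sympl_self (R : realType) (d : nat) (x : 'cV[R]_d) : sympl x x = 0.
Proof.
(* A 1 x 1 matrix is its own transpose, so [x, x] is its own opposite. *)
have : (x^T *m Omega R d *m x)^T ord0 ord0 = - sympl x x.
  by rewrite !trmx_mul trmxK Omega_tr mulNmx mulmxN mulmxA mxE.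
rewrite mxE -/(sympl x x) => /eqP.
by rewrite -subr_eq0 opprK -mulr2n mulrn_eq0 => /eqP.
Qed.

(** The Gram matrix is [mu] times the matrix of the signs of its entries; these
    are integers, so the parity criterion makes it invertible, while it factors
    through a space of dimension [d]. *)
Lemma equiangular_even_leq (R : realType) (d m : nat)
    (Phi : 'I_m -> 'cV[R]_d) :
  ~~ odd m -> equiangular Phi -> (m <= d)%N.
Proof.
move=> m_even [mu [mu_gt0 Phi_mu]].
pose B : 'M[R]_(d, m) := \matrix_(k, i) Phi i k ord0.
pose G := B^T *m Omega R d *m B.
have GE i j : G i j = sympl (Phi i) (Phi j).
  rewrite /G /sympl !mxE; apply: eq_bigr => k _; rewrite !mxE; congr (_ * _).
  by apply: eq_bigr => l _; rewrite !mxE.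
pose A : 'M[int]_m := \matrix_(i, j) sgz (sympl (Phi i) (Phi j)).
have GA : G = mu *: map_mx intr A.
  apply/matrixP => i j; rewrite GE !mxE.
  have [<-|/eqP ij] := eqVneq i j.
    by rewrite sympl_self sgz0 mulr0.
  by rewrite -(Phi_mu i j ij) -sgrEz mulrC -numEsg.
have A_parity i j : odd `|A i j|%N = (i != j).
  have odd_sgz (x : R) : odd `|sgz x|%N = (x != 0) by case: sgzP.
  rewrite mxE odd_sgz.
  have [<-|/eqP ij] := eqVneq i j; first by rewrite sympl_self eqxx.
  by rewrite -normr_eq0 Phi_mu // gt_eqF.
have G_unit : G \in unitmx.
  rewrite unitmxE GA detZ det_map_mx unitfE mulf_neq0 //.
    by rewrite expf_neq0 // gt_eqF.
  by rewrite intr_eq0 det_odd_offdiag_neq0.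
rewrite -(mxrank_unit G_unit).
exact: leq_trans (mxrankM_maxr _ _) (rank_leq_row _).
Qed.

Lemma equiangular_inj (R : realType) (d m n : nat) (Phi : 'I_n -> 'cV[R]_d)
    (f : 'I_m -> 'I_n) :
  injective f -> equiangular Phi -> equiangular (Phi \o f).
Proof.
move=> f_inj [mu [mu_gt0 Phi_mu]]; exists mu; split=> // i j ij.
by apply: Phi_mu => /f_inj.
Qed.

Theorem proposition25 (R : realType) (d n : nat) (hd : (2 <= d)%N)
    (hd_even : ~~ odd d) (Phi : 'I_n -> 'cV[R]_d) (hPhi : equiangular Phi) :
  (n <= d + 1)%N.
Proof.
rewrite addn1 leqNgt; apply/negP => lt_dn.
(* As [d] is even, so is [d + 2]: keep only the first [d + 2] vectors. *)
have f_inj : injective (widen_ord lt_dn) by move=> i j [] /val_inj.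
have := equiangular_even_leq _ (equiangular_inj f_inj hPhi).
by rewrite /= negbK hd_even => /(_ isT); rewrite ltnNge leqnSn.
Qed.
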